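(* Let $\Bbbk$ be a field and let $G$ be a finite, simple, connected, nontrivial graph with edge ideal $I(G)$. The following are equivalent: (1) the complement graph $G^c$ is $C_4$-free; (2) the LCM lattice $\mathcal{L}_{I(G)}$ is graded; (3) $I(G)$ is linearly presented. Moreover, in this case, if $1\neq m\in\mathcal{L}_{I(G)}$, then $\operatorname{rank}(m)=\deg(m)-1$.
   Context: A graph is nontrivial if it has at least one edge. For a graph $G$ on vertex set $\{1,\ldots,n\}$, $I(G)=(x_ix_j\mid\{i,j\}\in E(G))\subseteq S=\Bbbk[x_1,\ldots,x_n]$. $G^c$ has the same vertex set as $G$, and distinct $i,j$ are adjacent in $G^c$ iff they are not adjacent in $G$. A graph is $H$-free if it has no induced subgraph isomorphic to $H$; $C_4$ is the 4-cycle. (When $G^c$ is $C_4$-free, $G$ is called gap-free.) The LCM lattice $\mathcal{L}_I$ of a monomial ideal $I$ is the set of least common multiples of subsets of its minimal monomial generators (the lcm of the empty set is $1$), ordered by divisibility; it is a finite lattice with join lcm. A finite lattice $L$ is graded if it has an order-preserving function $\operatorname{rank}=\operatorname{rk}:L\to\mathbb{Z}$ with $\operatorname{rk}(\hat 0)=0$ and $\operatorname{rk}(y)=\operatorname{rk}(x)+1$ whenever $y$ covers $x$. With graded Betti numbers $\beta_{i,j}(M)=\dim_\Bbbk\operatorname{Tor}^S_i(M,\Bbbk)_j$, the ideal $I(G)$ (generated in degree 2) is linearly presented if $\beta_{2,j}(S/I(G))=0$ for all $j\neq 3$; equivalently $\beta_{2,4}(S/I(G))=0$. *)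

(* Defs.v *)
From HB Require Import structures.
From mathcomp Require Export all_boot all_order all_fingroup all_algebra.
From mathcomp Require Export mpoly.

Set Implicit Arguments.
Unset Strict Implicit.
Unset Printing Implicit Defensive.

Import GRing.Theory.
Local Open Scope ring_scope.

(* A finite simple graph on {1, .., n} is a symmetric irreflexive relation on
   'I_n. *)

Definition nontrivial_graph (n : nat) (e : rel 'I_n) : Prop :=
  exists i j : 'I_n, e i j.

Definition connected_graph (n : nat) (e : rel 'I_n) : Prop :=
  forall i j : 'I_n, connect e i j.

Definition complement_graph (n : nat) (e : rel 'I_n) : rel 'I_n :=
  [rel i j | (i != j) && ~~ e i j].

Definition C4 : rel 'I_4 := [rel i j : 'I_4 | (j == ordS i) || (i == ordS j)].

(* The induced subgraphs of [e] isomorphic to [h] are the images of the maps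
   [f] below. *)
Definition graph_free (m n : nat) (h : rel 'I_m) (e : rel 'I_n) : Prop :=
  ~ exists f : 'I_m -> 'I_n,
      injective f /\ forall i j : 'I_m, e (f i) (f j) = h i j.

Definition edge_ideal (k : fieldType) (n : nat) (e : rel 'I_n)
    (p : {mpoly k[n]}) : Prop :=
  exists c : 'I_n * 'I_n -> {mpoly k[n]},
    p = \sum_(u : 'I_n * 'I_n | e u.1 u.2) c u * ('X_u.1 * 'X_u.2).

Definition minimal_monomial_generator (k : fieldType) (n : nat)
    (I : {mpoly k[n]} -> Prop) (m : 'X_{1..n}) : Prop :=
  I 'X_[m] /\
  forall m' : 'X_{1..n}, I 'X_[m'] -> (m' <= m)%MM -> m' = m.

Definition lcm_lattice (k : fieldType) (n : nat)
    (I : {mpoly k[n]} -> Prop) (m : 'X_{1..n}) : Prop :=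
  exists A : seq 'X_{1..n},
    (forall a, a \in A -> minimal_monomial_generator I a) /\
    m = \big[@mlcm n/0%MM]_(a <- A) a.

Definition mdivides (n : nat) : rel 'X_{1..n} := [rel a b | (a <= b)%MM].

(* The poset is the subset [L] of [T], ordered by the restriction of [le]. *)

Definition covers (T : Type) (L : T -> Prop) (le : rel T) (x y : T) : Prop :=
  [/\ L x, L y, le x y, x <> y &
      forall z, L z -> le x z -> le z y -> z = x \/ z = y].

(* Only the values of [rk] on [L] matter. *)
Definition rank_function (T : Type) (L : T -> Prop) (le : rel T)
    (rk : T -> int) : Prop :=
  [/\ forall x y, L x -> L y -> le x y -> rk x <= rk y,
      forall b, L b -> (forall x, L x -> le b x) -> rk b = 0 &
      forall x y, covers L le x y -> rk y = rk x + 1].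

Definition graded_lattice (T : Type) (L : T -> Prop) (le : rel T) : Prop :=
  exists rk : T -> int, rank_function L le rk.

(* An entry of a degree 0 map S(-s) -> S(-t). *)
Definition homog_entry (k : fieldType) (n : nat) (s t : nat)
    (p : {mpoly k[n]}) : bool :=
  if (t <= s)%N then p \is (s - t).-homog else p == 0.

(* A graded free resolution ... -> F_2 -> F_1 -> F_0 -> S/I -> 0 of the cyclic
   module S/I (I a homogeneous ideal), with F_i the sum of the S(-d) over the
   degrees d of its finitely many basis elements.  Elements of F_i are row
   vectors; F_i.+1 -> F_i is v |-> v *m gfr_diff i, and F_0 -> S/I is
   v |-> v *m gfr_aug modulo I. *)
Record graded_free_resolution (k : fieldType) (n : nat)
    (I : {mpoly k[n]} -> Prop) := GradedFreeResolution {
  gfr_rank : nat -> nat;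
  gfr_deg : forall i : nat, 'I_(gfr_rank i) -> nat;
  gfr_diff : forall i : nat, 'M[{mpoly k[n]}]_(gfr_rank i.+1, gfr_rank i);
  gfr_aug : 'cV[{mpoly k[n]}]_(gfr_rank 0);
  gfr_diff_homog : forall i a b,
    homog_entry (gfr_deg a) (gfr_deg b) (gfr_diff i a b);
  gfr_aug_homog : forall a, homog_entry (gfr_deg a) 0 (gfr_aug a 0);
  gfr_aug_surj : forall p : {mpoly k[n]},
    exists v : 'rV_(gfr_rank 0), I ((v *m gfr_aug) 0 0 - p);
  gfr_exact0 : forall v : 'rV_(gfr_rank 0),
    I ((v *m gfr_aug) 0 0) <-> exists w, v = w *m gfr_diff 0;
  gfr_exact : forall (i : nat) (v : 'rV_(gfr_rank i.+1)),
    v *m gfr_diff i = 0 <-> exists w, v = w *m gfr_diff i.+1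
}.

Section Betti.
Variables (k : fieldType) (n : nat) (I : {mpoly k[n]} -> Prop).
Variable F : graded_free_resolution I.

(* The differential of F (x)_S k, where k = S/(x_1, .., x_n): only the constant
   terms of the entries survive. *)
Definition tensor_diff (i : nat) : 'M[k]_(gfr_rank F i.+1, gfr_rank F i) :=
  map_mx (fun p : {mpoly k[n]} => p@_0%MM) (gfr_diff F i).

(* Row space: the degree j component of F_i (x)_S k. *)
Definition tensor_degree (i j : nat) : 'M[k]_(gfr_rank F i) :=
  diag_mx (\row_a (gfr_deg (g := F) a == j)%:R).

Definition tensor_cycles (i : nat) : 'M[k]_(gfr_rank F i) :=
  match i with
  | 0 => 1%:M
  | i'.+1 => kermx (tensor_diff i')
  end.

(* dim_k Tor_i^S(S/I, k)_j, as the homology of F (x)_S k. *)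
Definition tor_dim (i j : nat) : nat :=
  (\rank (tensor_cycles i :&: tensor_degree i j)%MS
   - \rank (tensor_diff i :&: tensor_degree i j)%MS)%N.

End Betti.

(* [graded_betti I i j b] means beta_{i,j}(S/I) = b.  The dimension of Tor does
   not depend on the resolution used to compute it. *)
Definition graded_betti (k : fieldType) (n : nat) (I : {mpoly k[n]} -> Prop)
    (i j b : nat) : Prop :=
  exists F : graded_free_resolution I, tor_dim F i j = b.

Definition linearly_presented (k : fieldType) (n : nat)
    (I : {mpoly k[n]} -> Prop) : Prop :=
  forall j : nat, j <> 3%N -> graded_betti I 2 j 0.

(* Main.v *)
(** The complement of [e] is C4-free exactly when [e] has no gap, i.e. no two
    disjoint edges with no edge between them.

    The lcm lattice consists of the squarefree monomials of the vertex sets [W]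
    inducing a subgraph without isolated vertices. Without gaps, any proper
    inclusion [W < W'] of such nonempty sets can start by adding one vertex, so
    covers raise the degree by one. A gap [a, b, c, d] makes [abcd] cover [ab];
    by connectedness both sets also grow one vertex at a time to the full vertex
    set, which yields maximal chains of different lengths.

    Without gaps, the Taylor resolution gives Tor_2 = 0 in degrees other than 3:
    for disjoint edges [u], [v] joined by an edge [w], the boundary of [(u, w, v)]
    is [- (u, v)] modulo the maximal ideal. Conversely, if [alpha], [beta] are the
    monomials of a gap, setting the other variables to 0 maps S/I onto
    S/(alpha, beta), and the Koszul complex of [(alpha, beta)] maps into any
    resolution of S/I and back, the composite being the identity modulo the
    maximal ideal; so Tor_2 of S/I is nonzero in degree 4. *)

From HB Require Import structures.
Require Import Defs.
From mathcomp Require Import zify ring.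

Set Implicit Arguments.
Unset Strict Implicit.
Unset Printing Implicit Defensive.

Import GRing.Theory Num.Theory.
Local Open Scope ring_scope.

(** * Monomials *)

Section Monomials.
Variables (k : fieldType) (n : nat).
Implicit Types (p q : {mpoly k[n]}) (m : 'X_{1..n}).

Lemma lem_trans m1 m2 m3 : (m1 <= m2)%MM -> (m2 <= m3)%MM -> (m1 <= m3)%MM.
Proof.
move=> /mnm_lepP h12 /mnm_lepP h23; apply/mnm_lepP => i.
exact: leq_trans (h12 i) (h23 i).
Qed.

Lemma lem_mdeg m1 m2 : (m1 <= m2)%MM -> (mdeg m1 <= mdeg m2)%N.
Proof. by move=> /submK <-; rewrite mdegD leq_addl. Qed.

Lemma lem_mdeg_eq m1 m2 : (m1 <= m2)%MM -> mdeg m1 = mdeg m2 -> m1 = m2.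
Proof.
move=> le12 eq12; have E := submK le12.
have : mdeg (m2 - m1) == 0%N.
  by rewrite -(eqn_add2r (mdeg m1)) -mdegD E eq12.
by rewrite mdeg_eq0 => /eqP z; rewrite -E z addmC addm0.
Qed.

Lemma mcoeffMXE p l m :
  (p * 'X_[l])@_m = if (l <= m)%MM then p@_(m - l) else 0.
Proof.
case: ifP => [le_lm|/negP nle]; first by rewrite -[in LHS](submK le_lm) addmC mcoeffMX.
apply: memN_msupp_eq0; rewrite (perm_mem (msuppMX p l)).
by apply/mapP => -[m' _ def_m]; case: nle; rewrite def_m lem_addr.
Qed.

Lemma mpolyX_divP p l :
  (forall m, m \in msupp p -> (l <= m)%MM) <-> exists q, p = q * 'X_[l].
Proof.
split=> [le_l|[q ->] m].
  exists (\sum_(m <- msupp p) p@_m *: 'X_[m - l]).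
  rewrite {1}[p]mpolyE mulr_suml big_seq [RHS]big_seq.
  by apply: eq_bigr => m /le_l h; rewrite -scalerAl -mpolyXD submK.
by rewrite mcoeff_msupp mcoeffMXE; case: ifP => // _; rewrite eqxx.
Qed.

(** Projection onto the span of the monomials in [A]. It sorts a polynomial by divisors and, later,
    sets variables to 0. *)
Definition mfilter (A : pred 'X_{1..n}) p : {mpoly k[n]} :=
  \sum_(m <- msupp p | A m) p@_m *: 'X_[m].

Lemma mcoeff_mfilter A p m : (mfilter A p)@_m = if A m then p@_m else 0.
Proof.
rewrite /mfilter raddf_sum /= big_mkcond /=.
have [m_p|/memN_msupp_eq0 p0] := boolP (m \in msupp p); last first.
  rewrite p0 if_same big1_seq // => m' /andP[_ m'_p].
  case: ifP => // _; rewrite mcoeffZ mcoeffX.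
  by case: eqP m'_p => [->|]; rewrite ?mulr0 // mcoeff_msupp p0 eqxx.
rewrite (bigD1_seq m) //= ?msupp_uniq // big1 => [|m' neq].
  by rewrite addr0 mcoeffZ mcoeffX eqxx mulr1.
by case: ifP => // _; rewrite mcoeffZ mcoeffX (negPf neq) mulr0.
Qed.

Lemma mfilter_is_additive A : zmod_morphism (mfilter A).
Proof.
move=> p q; apply/mpolyP => m; rewrite mcoeffB !mcoeff_mfilter mcoeffB.
by case: ifP => _; rewrite ?subr0.
Qed.

HB.instance Definition _ A :=
  GRing.isZmodMorphism.Build {mpoly k[n]} {mpoly k[n]} (mfilter A)
    (mfilter_is_additive A).

Lemma msupp_mfilter A p m : (m \in msupp (mfilter A p)) = A m && (m \in msupp p).
Proof. by rewrite !mcoeff_msupp mcoeff_mfilter; case: (A m); rewrite ?eqxx. Qed.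

Lemma mfilterX (A : pred _) m : A m -> mfilter A 'X_[m] = 'X_[m].
Proof.
move=> Am; apply/mpolyP => m'; rewrite mcoeff_mfilter mcoeffX.
by case: eqP => [<-|]; rewrite ?Am ?if_same.
Qed.

(** * Membership in monomial ideals *)

Section Generators.
Variables (T : finType) (P : pred T) (g : T -> 'X_{1..n}).

(** A fixed choice for each monomial, which partitions every support into pieces cut out by additive
    maps. *)
Definition divisor m : option T := [pick u | P u && (g u <= m)%MM].

Lemma sum_mfilter_divisor p :
  (forall m, m \in msupp p -> exists u, P u && (g u <= m)%MM) ->
  p = \sum_(u | P u) mfilter (fun m => divisor m == Some u) p.
Proof.
move=> Pp; apply/mpolyP => m; rewrite raddf_sum /=.
under eq_bigr do rewrite mcoeff_mfilter.
have [/Pp m_p|/memN_msupp_eq0 ->] := boolP (m \in msupp p); last first.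
  by rewrite big1 // => u _; rewrite if_same.
rewrite /divisor; case: pickP => [u /andP[Pu _]|none]; last first.
  by case: m_p => u; rewrite none.
rewrite (bigD1 u) //= eqxx big1 ?addr0 // => v /andP[_ neq].
by case: ifP => // /eqP[uv]; rewrite uv eqxx in neq.
Qed.

(** Sorting the monomials of [p] by their chosen divisor yields the coefficients [c]. *)
Lemma monomial_idealP p :
  (exists c : T -> {mpoly k[n]}, p = \sum_(u | P u) c u * 'X_[g u]) <->
  (forall m, m \in msupp p -> exists u, P u && (g u <= m)%MM).
Proof.
split=> [[c ->] m|/[dup] Pp /sum_mfilter_divisor def_p].
  rewrite mcoeff_msupp raddf_sum /= => nz; case: (pickP [pred u | P u && (g u <= m)%MM]).
    by move=> u; exists u.
  move=> none; rewrite big1 ?eqxx // in nz => u Pu.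
  by have := none u; rewrite /= Pu /= mcoeffMXE => ->.
suff /fin_all_exists[c Hc] u : exists q,
    P u -> mfilter (fun m => divisor m == Some u) p = q * 'X_[g u].
  by exists c; rewrite {1}def_p; apply: eq_bigr => u /Hc.
have /mpolyX_divP[q ->] : forall m,
    m \in msupp (mfilter (fun m => divisor m == Some u) p) -> (g u <= m)%MM.
  move=> m; rewrite msupp_mfilter /divisor => /andP[+ _].
  by case: pickP => // v /andP[_ le_v] /eqP[<-].
by exists q.
Qed.

End Generators.

End Monomials.

Definition edge_mon (n : nat) (u : 'I_n * 'I_n) : 'X_{1..n} :=
  (U_(u.1) + U_(u.2))%MM.

Lemma mdeg_edge_mon (n : nat) (u : 'I_n * 'I_n) : mdeg (edge_mon u) = 2%N.
Proof. by rewrite mdegD !mdeg1. Qed.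

Lemma edge_idealP (k : fieldType) (n : nat) (e : rel 'I_n) (p : {mpoly k[n]}) :
  edge_ideal e p <->
  forall m, m \in msupp p -> exists u, e u.1 u.2 && (edge_mon u <= m)%MM.
Proof.
rewrite -monomial_idealP; split=> -[c ->]; exists c; apply: eq_bigr => u _.
  by rewrite mpolyXD.
by rewrite mpolyXD.
Qed.

Definition mset (n : nat) (W : {set 'I_n}) : 'X_{1..n} :=
  [multinom (i \in W : nat) | i < n].

(** * Vertex sets as squarefree monomials *)

Section SquarefreeMonomials.
Variable n : nat.
Implicit Types A B W : {set 'I_n}.

Lemma mset_le A B : (mset A <= mset B)%MM = (A \subset B).
Proof.
apply/mnm_lepP/subsetP => le_AB i; last first.
  by rewrite !mnmE; case: (boolP (i \in A)) => // /le_AB ->.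
by move=> iA; have := le_AB i; rewrite !mnmE iA; case: (i \in B).
Qed.

Lemma mset_inj : injective (@mset n).
Proof.
move=> A B eqAB; apply/eqP; rewrite eqEsubset -!mset_le eqAB.
by apply/andP; split; apply/mnm_lepP.
Qed.

Lemma mset0 : mset set0 = 0%MM :> 'X_{1..n}.
Proof. by apply/mnmP => i; rewrite mnm0E mnmE inE. Qed.

Lemma mdeg_mset A : mdeg (mset A) = #|A|.
Proof.
rewrite mdegE -sum1_card [RHS]big_mkcond /=.
by apply: eq_bigr => i _; rewrite mnmE; case: (i \in A).
Qed.

Lemma msetU : {morph (@mset n) : A B / A :|: B >-> mlcm A B}.
Proof.
by move=> A B; apply/mnmP => i; rewrite !mnmE inE; case: (i \in A); case: (i \in B).
Qed.

Lemma edge_mon_mset (i j : 'I_n) : i != j -> edge_mon (i, j) = mset [set i; j].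
Proof.
move=> neq; apply/mnmP => l; rewrite mnmDE !mnm1E mnmE !inE !(eq_sym l).
by case: (i =P l) => [<-|] //; rewrite (eq_sym j) (negPf neq).
Qed.

End SquarefreeMonomials.

(** * The lcm lattice *)

Definition gap_free (n : nat) (e : rel 'I_n) : Prop :=
  forall a b c d, e a b -> e c d ->
    [|| a == c, a == d, b == c, b == d, e a c, e a d, e b c | e b d].

(** The two edges of a gap are the diagonals of an induced 4-cycle of the complement. *)
Lemma gap_freeP (n : nat) (e : rel 'I_n)
    (e_sym : ssrbool.symmetric e) (e_irr : irreflexive e) :
  graph_free C4 (complement_graph e) <-> gap_free e.
Proof.
split=> [noC4 a b c d ab cd|gapf [f [f_inj fE]]].
  apply/negPn/negP; rewrite !negb_or => /and5P[ac ad bc bd /and4P[eac ead ebc ebd]].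
  have neq_ab : a != b by apply: contraTneq ab => ->; rewrite e_irr.
  have neq_cd : c != d by apply: contraTneq cd => ->; rewrite e_irr.
  (* In the cyclic order [a], [c], [b], [d] the edges [ab] and [cd] become the diagonals. *)
  apply: noC4; exists (tnth [tuple a; c; b; d]); split.
    move=> [[|[|[|[|//]]]] i] [[|[|[|[|//]]]] j]; rewrite !(tnth_nth a) /= => E;
      apply: val_inj => //=; move: neq_ab neq_cd ac ad bc bd; by rewrite E eqxx.
  have simp := (negPf ac, negPf ad, negPf bc, negPf bd, negPf eac, negPf ead,
    negPf ebc, negPf ebd, negPf neq_ab, negPf neq_cd, ab, cd, eqxx).
  move=> [[|[|[|[|//]]]] i] [[|[|[|[|//]]]] j];
    rewrite !(tnth_nth a) /= /C4 /complement_graph /= ?simp // -?[_ == ordS _]val_eqE /=;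
    by rewrite eq_sym e_sym !simp.
have edge (i j : 'I_4) : i != j -> ~~ C4 i j -> e (f i) (f j).
  by move=> neq; rewrite -fE /complement_graph /= (inj_eq f_inj) neq /= negbK.
have nonedge (i j : 'I_4) : C4 i j -> (f i == f j) || e (f i) (f j) = false.
  by rewrite -fE /complement_graph /= -negb_or => /negPf.
pose o (i : nat) : 'I_4 := inord i.
have oE i : (i < 4)%N -> o i = i :> nat by move=> lt_i4; rewrite inordK.
(* The diagonals 02 and 13 are edges of [e]; each of the eight alternatives contradicts a side of
   the cycle. *)
have := gapf _ _ _ _ (edge (o 0%N) (o 2%N) _ _) (edge (o 1%N) (o 3%N) _ _).
rewrite /C4 /= -!val_eqE /= !oE //= => /(_ isT isT isT isT).
have := nonedge (o 0%N) (o 1%N); have := nonedge (o 0%N) (o 3%N).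
have := nonedge (o 2%N) (o 1%N); have := nonedge (o 2%N) (o 3%N).
rewrite /C4 /= -!val_eqE /= !oE //= => /(_ isT)/norP[/negPf-> /negPf->].
move=> /(_ isT)/norP[/negPf-> /negPf->] /(_ isT)/norP[/negPf-> /negPf->].
by move=> /(_ isT)/norP[/negPf-> /negPf->].
Qed.

Section Lattice.
Variables (k : fieldType) (n : nat) (e : rel 'I_n).
Hypotheses (e_sym : ssrbool.symmetric e) (e_irr : irreflexive e).
Implicit Types A B W : {set 'I_n}.

Definition no_isolated W := [forall i in W, [exists j in W, e i j]].

Lemma no_isolatedP W :
  reflect (forall i, i \in W -> exists2 j, j \in W & e i j) (no_isolated W).
Proof.
apply: (iffP 'forall_in_exists_inP) => H i /H[j jW eij]; by exists j.
Qed.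

Lemma no_isolatedU A B :
  no_isolated A -> no_isolated B -> no_isolated (A :|: B).
Proof.
move=> /no_isolatedP nA /no_isolatedP nB; apply/no_isolatedP => i /setUP[].
  by case/nA=> j jA; exists j => //; rewrite inE jA.
by case/nB=> j jB; exists j => //; rewrite inE jB orbT.
Qed.

Lemma edge_neq i j : e i j -> i != j.
Proof. by apply: contraTneq => ->; rewrite e_irr. Qed.

Lemma no_isolated_edge i j : e i j -> no_isolated [set i; j].
Proof.
move=> eij; apply/no_isolatedP => l /set2P[]->.
  by exists j; rewrite ?set22.
by exists i; rewrite ?set21 // e_sym.
Qed.

Lemma no_isolated_add W v : no_isolated W ->
  (exists2 w, w \in W & e v w) -> no_isolated (v |: W).
Proof.
move=> /no_isolatedP nW [w wW evw]; apply/no_isolatedP => i /setU1P[->|iW].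
  by exists w => //; rewrite setU1r.
by have [j jW eij] := nW i iW; exists j => //; rewrite setU1r.
Qed.

Lemma no_isolated_card W : no_isolated W -> W != set0 -> (2 <= #|W|)%N.
Proof.
move=> /no_isolatedP nW /set0Pn[i iW]; have [j jW /edge_neq neq] := nW i iW.
rewrite (cardsD1 i) iW (cardsD1 j) !inE jW eq_sym neq /=; lia.
Qed.

(** All edge monomials have degree 2, so none properly divides another. *)
Lemma minimal_edge_mon (m : 'X_{1..n}) :
  minimal_monomial_generator (@edge_ideal k n e) m <->
  exists i j, e i j /\ m = mset [set i; j].
Proof.
have mem_I m' : edge_ideal (k := k) e 'X_[m'] <->
    exists u, e u.1 u.2 && (edge_mon u <= m')%MM.
  split=> [/edge_idealP /(_ m')|h]; first by apply; rewrite msuppX inE.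
  by apply/edge_idealP => m''; rewrite msuppX inE => /eqP->.
split=> [[/mem_I[[i j] /= /andP[eij le_m] min_m]]|[i [j [eij ->]]]].
  exists i, j; split=> //; rewrite -edge_mon_mset ?edge_neq // (min_m (edge_mon (i, j))) //.
  by apply/mem_I; exists (i, j); rewrite /= eij; apply/mnm_lepP.
rewrite -edge_mon_mset ?edge_neq //; split=> [|m' /mem_I[u /andP[eu le_um']] le_m'].
  by apply/mem_I; exists (i, j); rewrite /= eij; apply/mnm_lepP.
have eq_u : edge_mon u = edge_mon (i, j).
  by apply: lem_mdeg_eq; [exact: lem_trans le_um' le_m'|rewrite !mdeg_edge_mon].
apply: lem_mdeg_eq => //; apply/eqP; rewrite eqn_leq lem_mdeg //= -eq_u.
exact: lem_mdeg.
Qed.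

(** The lcm of squarefree monomials is a union of vertex sets, and [W] without isolated vertices is
    the union of the edges inside it. *)
Lemma lcm_latticeP (m : 'X_{1..n}) :
  lcm_lattice (@edge_ideal k n e) m <-> exists2 W, no_isolated W & m = mset W.
Proof.
split=> [[s [s_gen ->]]|[W /no_isolatedP nW ->]].
  elim: s s_gen => [|a s IHs] s_gen.
    by exists set0; rewrite ?big_nil ?mset0 //; apply/no_isolatedP => i; rewrite inE.
  case: IHs => [b b_s|W nW def_W]; first by apply: s_gen; rewrite inE b_s orbT.
  have /minimal_edge_mon[i [j [eij def_a]]] := s_gen a (mem_head _ _).
  exists ([set i; j] :|: W); first by rewrite no_isolatedU ?no_isolated_edge.
  by rewrite big_cons def_W def_a -msetU.
pose D := [pred u : 'I_n * 'I_n | [&& u.1 \in W, u.2 \in W & e u.1 u.2]].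
exists [seq mset [set u.1; u.2] | u <- enum D]; split=> [a|].
  case/mapP=> -[i j]; rewrite mem_enum => /and3P[_ _ /= eij] ->.
  by apply/minimal_edge_mon; exists i, j.
rewrite big_map -(big_morph _ (@msetU n) (mset0 n)) big_enum /=; congr mset.
apply/setP => i; apply/idP/bigcupP => [iW|[u]].
  have [j jW eij] := nW i iW; exists (i, j); first exact/and3P.
  by rewrite set21.
by case/and3P=> uW vW _ /set2P[]->.
Qed.

Lemma lcm_lattice_mset W :
  lcm_lattice (@edge_ideal k n e) (mset W) <-> no_isolated W.
Proof.
rewrite lcm_latticeP; split=> [[A nA /mset_inj->]|nW] //; by exists W.
Qed.

Local Notation L := (lcm_lattice (@edge_ideal k n e)).

Lemma covers_mset A B :
  covers L (@mdivides n) (mset A) (mset B) <->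
  [/\ no_isolated A, no_isolated B, A \proper B &
      forall C, no_isolated C -> A \subset C -> C \subset B -> C = A \/ C = B].
Proof.
split=> [[/lcm_lattice_mset nA /lcm_lattice_mset nB]|[nA nB /andP[sAB sBA] minB]].
  rewrite /mdivides /= mset_le => sAB neqAB minB; split=> // [|C nC sAC sCB].
    by rewrite properEneq sAB andbT; apply/eqP => eqAB; case: neqAB; rewrite eqAB.
  have LC : L (mset C) by exact/lcm_lattice_mset.
  by case: (minB (mset C)) => [||||]; rewrite ?mset_le // => /mset_inj; [left|right].
split; rewrite /mdivides /= ?mset_le //; try exact/lcm_lattice_mset.
  by move/mset_inj=> eqAB; rewrite eqAB subxx in sBA.
move=> z /lcm_latticeP[C nC ->]; rewrite !mset_le => sAC sCB.
by case: (minB C nC sAC sCB) => ->; [left|right].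
Qed.

Lemma covers_add A v : no_isolated A -> v \notin A ->
  no_isolated (v |: A) -> covers L (@mdivides n) (mset A) (mset (v |: A)).
Proof.
move=> nA vA nvA; apply/covers_mset; split=> [//|//||C nC sAC sCB].
  by rewrite properEcard subsetUr cardsU1 vA /=.
case: (boolP (v \in C)) => vC; [right|left]; apply/eqP; rewrite eqEsubset.
  by rewrite sCB subUset sub1set vC.
rewrite sAC andbT; apply/subsetP => i iC.
have /setU1P[eq_iv|//] := subsetP sCB i iC.
by rewrite -eq_iv iC in vC.
Qed.

(** * Gap-free graphs: gradedness and the rank formula *)

Section GapFree.
Hypothesis gapf : gap_free e.

(* If [A] has no neighbour in [B] outside [A], then [B] contains an edge avoiding
   [A], and being gap-free attaches one of its ends to [A]. *)
Lemma gap_free_grow A B : no_isolated A -> no_isolated B -> A != set0 ->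
  A \proper B ->
  exists v, [/\ v \in B, v \notin A & no_isolated (v |: A)].
Proof.
move=> nA nB /set0Pn[a aA] /properP[sAB [v vB vA]].
have [u uB evu] := no_isolatedP _ nB v vB.
have [b bA eab] := no_isolatedP _ nA a aA.
have [uA|uA] := boolP (u \in A).
  by exists v; split=> //; apply: no_isolated_add => //; exists u.
have grow x w : x \in B -> x \notin A -> w \in A -> e w x ->
    exists v, [/\ v \in B, v \notin A & no_isolated (v |: A)].
  move=> xB xA wA ewx; exists x; split=> //.
  by apply: no_isolated_add => //; exists w; rewrite 1?e_sym.
have neq x w : x \in A -> w \notin A -> (x == w) = false.
  by move=> xA; apply: contraNF => /eqP <-.
have := gapf eab evu; rewrite !neq //= => /or4P[] ?.
- exact: (grow v a).
- exact: (grow u a).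
- exact: (grow v b).
- exact: (grow u b).
Qed.

(** The one-vertex growth of [A] must already reach [B]. From the empty set the smallest step is a
    whole edge, whence the 2. *)
Lemma gap_free_covers A B : covers L (@mdivides n) (mset A) (mset B) ->
  if A == set0 then #|B| = 2%N else #|B| = #|A|.+1.
Proof.
case/covers_mset=> nA nB pAB minB; case: eqP => [A0|/eqP A0].
  move: pAB; rewrite A0 proper0 => /set0Pn[i iB].
  have [j jB eij] := no_isolatedP _ nB i iB.
  case: (minB [set i; j]) => [|||eqA|<-].
  - exact: no_isolated_edge.
  - by rewrite A0 sub0set.
  - by rewrite subUset !sub1set iB.
  - by have := set21 i j; rewrite eqA A0 inE.
  by rewrite cards2 (edge_neq eij).
have [v [vB vA nvA]] := gap_free_grow nA nB A0 pAB.
case: (minB (v |: A)) => [|||eqA|<-] //.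
- exact: subsetUr.
- by rewrite subUset sub1set vB proper_sub.
- by rewrite -eqA setU11 in vA.
by rewrite cardsU1 vA.
Qed.

(** [A] is maximal among the proper subsets without isolated vertices; the empty set is one of
    them. *)
Lemma covers_below B : no_isolated B -> B != set0 ->
  exists2 A : {set 'I_n}, A \proper B & covers L (@mdivides n) (mset A) (mset B).
Proof.
move=> nB B0; pose P (A : {set 'I_n}) := no_isolated A && (A \proper B).
have P0 : P set0.
  by rewrite /P proper0 B0 andbT; apply/no_isolatedP => i; rewrite inE.
have [A /maxsetP[/andP[nA pAB] maxA] _] := maxset_exists P0.
exists A => //; apply/covers_mset; split=> // C nC sAC sCB.
have [->|neq] := eqVneq C B; first by right.
by left; apply: maxA => //; rewrite /P nC properEneq neq.
Qed.

(** Descending through covers lowers degree and rank by one each time, except for the last step,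
    from an edge to 1, which lowers the degree by two. *)
Lemma gap_free_rank rk : rank_function L (@mdivides n) rk ->
  forall m, L m -> m <> 0%MM -> rk m = ((mdeg m)%:Z - 1)%R.
Proof.
case=> _ rk0 rkS m /lcm_latticeP[W nW ->]; rewrite mdeg_mset => W0.
have {}W0 : W != set0 by apply: contra_not_neq W0 => ->; exact: mset0.
have [d le_d] := ubnP #|W|; elim: d W nW W0 le_d => // d IHd W nW W0 le_d.
have [A pAW covA] := covers_below nW W0.
rewrite (rkS _ _ covA); have := gap_free_covers covA.
have /covers_mset[nA _ _ _] := covA.
case: eqP => [->|/eqP A0] cardW; last first.
  rewrite IHd //; first by rewrite cardW; lia.
  by rewrite cardW in le_d; lia.
rewrite rk0 ?cardW //; first by apply/lcm_lattice_mset/no_isolatedP => i; rewrite inE.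
by move=> m' _; apply/mnm_lepP => i; rewrite mset0 mnm0E.
Qed.

Lemma gap_free_graded : graded_lattice L (@mdivides n).
Proof.
(* The bottom is set apart, since the degree formula would give -1 there. *)
exists (fun m => if m == 0%MM then 0 else (mdeg m)%:Z - 1).
have deg W : no_isolated W -> (if mset W == 0%MM then 0 else (mdeg (mset W))%:Z - 1)
    = (if W == set0 then 0 else #|W|%:Z - 1).
  by move=> _; rewrite -mset0 (inj_eq (@mset_inj n)) mdeg_mset.
split.
- move=> _ _ /lcm_latticeP[A nA ->] /lcm_latticeP[B nB ->].
  rewrite /mdivides /= mset_le => sAB; rewrite !deg //.
  have leAB := subset_leq_card sAB.
  case: eqP => A0; last first.
    case: eqP => [B0|]; last by lia.
    by case: A0; apply/eqP; rewrite -subset0 -B0.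
  by case: eqP => // /eqP B0; have := no_isolated_card nB B0; lia.
- move=> _ /lcm_latticeP[W nW ->] /(_ 0%MM) le0.
  have : (mset W <= mset set0)%MM.
    rewrite mset0; apply: le0; rewrite -mset0; apply/lcm_lattice_mset.
    by apply/no_isolatedP => i; rewrite inE.
  by rewrite mset_le subset0 => /eqP ->; rewrite mset0 eqxx.
move=> x y /[dup] cov [/lcm_latticeP[A nA defA] /lcm_latticeP[B nB defB] _ _ _].
move: cov; rewrite defA defB => cov; have := gap_free_covers cov.
have /covers_mset[_ _ pAB _] := cov; rewrite !deg //.
have -> : (B == set0) = false.
  by apply/negbTE; case/properP: pAB => _ [b bB _]; apply/set0Pn; exists b.
by case: eqP => _ ->; lia.
Qed.

End GapFree.

(** * Connected graphs: gradedness excludes gaps *)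

Section Connected.
Hypothesis e_conn : connected_graph e.

(** Otherwise [W] would be closed under adjacency, hence everything by connectedness. *)
Lemma connected_grow W : W != set0 -> W != setT ->
  exists2 v, v \notin W & exists2 w, w \in W & e v w.
Proof.
move=> /set0Pn[i iW] WT.
have /subsetPn[j _ jW] : ~~ (setT \subset W) by rewrite subTset.
have [/exists_inP[v vW /exists_inP[w wW evw]]|none] :=
    boolP [exists (v | v \notin W), [exists (w | w \in W), e v w]].
  by exists v => //; exists w.
have cl : closed e (mem W).
  have step x y : e x y -> x \in W -> y \in W.
    move=> exy xW; apply/negPn/negP => yW; case/negP: none.
    by apply/exists_inP; exists y => //; apply/exists_inP; exists x; rewrite 1?e_sym.
  move=> x y exy; apply/idP/idP; first exact: step.
  by apply: step; rewrite e_sym.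
by have := closed_connect cl (e_conn i j); rewrite /= iW (negPf jW).
Qed.

(** Adding adjacent vertices one at a time gives a chain of covers from [W] to the full vertex
    set. *)
Lemma rank_top rk : rank_function L (@mdivides n) rk ->
  forall W, no_isolated W -> W != set0 ->
  rk (mset setT) = rk (mset W) + (n%:Z - #|W|%:Z).
Proof.
case=> _ _ rkS W nW W0; have [d le_d] := ubnP (n - #|W|).
have cardT : #|[set: 'I_n]| = n by rewrite cardsT card_ord.
elim: d W nW W0 le_d => // d IHd W nW W0 le_d.
have [->|WT] := eqVneq W setT; first by rewrite cardT subrr addr0.
have [v vW adj] := connected_grow W0 WT.
have nvW := no_isolated_add nW adj.
have leW : (#|v |: W| <= n)%N by rewrite -[leqRHS]cardT subset_leq_card ?subsetT.
have cardW : #|v |: W| = #|W|.+1 by rewrite cardsU1 vW.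
rewrite (IHd (v |: W)) //; last by rewrite cardW in leW *; lia.
  by rewrite (rkS _ _ (covers_add nW vW nvW)) cardW; lia.
by apply/set0Pn; exists v; rewrite setU11.
Qed.

(** For a gap, comparing the top rank through [A] and through [B] makes their ranks differ by 2,
    while [B] covers [A]. *)
Lemma graded_gap_free : graded_lattice L (@mdivides n) -> gap_free e.
Proof.
case=> rk rk_fun a b c d ab cd; apply/negPn/negP.
rewrite !negb_or => /and5P[ac ad bc bd /and4P[eac ead ebc ebd]].
pose A := [set a; b]; pose B := [set a; b] :|: [set c; d].
have nA : no_isolated A by exact: no_isolated_edge.
have nB : no_isolated B by rewrite no_isolatedU ?no_isolated_edge.
have A0 : A != set0 by apply/set0Pn; exists a; rewrite set21.
have B0 : B != set0 by apply/set0Pn; exists a; rewrite inE set21.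
have cardA : #|A| = 2%N by rewrite cards2 (edge_neq ab).
have dis : [set a; b] :&: [set c; d] = set0.
  apply/setP => i; rewrite !inE; apply/negbTE/negP => /andP[].
  case/orP=> /eqP-> /orP[]; exact/negP.
have cardB : #|B| = 4%N by rewrite cardsU dis cards0 !cards2 (edge_neq ab) (edge_neq cd).
have cov : covers L (@mdivides n) (mset A) (mset B).
  apply/covers_mset; split=> // [|C nC sAC sCB].
    by rewrite properEcard subsetUl cardA cardB.
  have in_cd x : x \in C -> x \notin A -> (x == c) || (x == d).
    by move=> /(subsetP sCB); rewrite !inE; case: (x == a); case: (x == b).
  have no_adj x : x \in [set c; d] -> forall y, y \in A -> ~~ e x y.
    move=> /set2P[]-> y /set2P[]->; rewrite e_sym //.
  have [sCA|/subsetPn[x xC xA]] := boolP (C \subset A).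
    by left; apply/eqP; rewrite eqEsubset sCA.
  (* [C] contains an end [x] of [cd]; the neighbour of [x] in [C] is outside [A] for lack of edges,
     so it is the other end. *)
  right; apply/eqP; rewrite eqEsubset sCB /= subUset sAC /=.
  have xcd := in_cd x xC xA.
  have [y yC exy] := no_isolatedP _ nC x xC.
  have yA : y \notin A by apply: contraL exy; apply: no_adj; rewrite !inE.
  have ycd := in_cd y yC yA; have neq := edge_neq exy.
  rewrite subUset !sub1set.
  by case/orP: xcd => /eqP xE; case/orP: ycd => /eqP yE; move: neq xC yC;
    rewrite xE yE ?eqxx // => _ -> ->.
have := rank_top rk_fun nA A0; rewrite (rank_top rk_fun nB B0) cardA cardB.
by case: rk_fun => _ _ /(_ _ _ cov) ->; lia.
Qed.

End Connected.

End Lattice.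

(** * A Taylor resolution on ordered tuples *)

Section OrderedChains.
Variable T : finType.

(* Boundary of the ordered chain complex of the full simplex on [T], where the
   chain [f] gives the simplex [t] the coefficient [f t]: the coefficient of [t]
   in the boundary is the alternating sum over the insertions of a vertex. *)
Fixpoint boundary (V : zmodType) (t : seq T) (f : seq T -> V) : V :=
  if t is t0 :: t' then
    \sum_c f [:: c, t0 & t'] - boundary t' (fun u => f (t0 :: u))
  else \sum_c f [:: c].

Lemma eq_boundary (V : zmodType) t (f g : seq T -> V) :
  (forall u, size u = (size t).+1 -> {subset t <= u} -> f u = g u) ->
  boundary t f = boundary t g.
Proof.
elim: t f g => [|t0 t IHt] f g eq_fg /=; first by apply: eq_bigr => c _; apply: eq_fg.
congr (_ - _).
  by apply: eq_bigr => c _; apply: eq_fg => // x; rewrite !inE => ->; rewrite orbT.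
apply: IHt => u sz_u sub_u; apply: eq_fg; first by rewrite /= sz_u.
by move=> x; rewrite !inE => /orP[->//|/sub_u->]; rewrite orbT.
Qed.

Lemma boundary_morph (V W : zmodType) (phi : {additive V -> W}) t f :
  phi (boundary t f) = boundary t (phi \o f).
Proof.
elim: t f => [|t0 t IHt] f /=; first by rewrite raddf_sum.
by rewrite raddfB raddf_sum IHt.
Qed.

Lemma boundary_sum (V : zmodType) (I : Type) (r : seq I) (P : pred I) t
    (F : I -> seq T -> V) :
  boundary t (fun u => \sum_(i <- r | P i) F i u) =
  \sum_(i <- r | P i) boundary t (F i).
Proof.
elim: t F => [|t0 t IHt] F /=; first by rewrite exchange_big.
by rewrite IHt exchange_big -sumrB.
Qed.

Lemma boundaryB (V : zmodType) t (f g : seq T -> V) :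
  boundary t (fun u => f u - g u) = boundary t f - boundary t g.
Proof.
elim: t f g => [|t0 t IHt] f g /=; rewrite ?IHt sumrB // !opprD !opprK.
by rewrite addrACA.
Qed.

Lemma boundary0 (V : zmodType) t : boundary t (fun=> 0 : V) = 0.
Proof. by elim: t => [|t0 t IHt] /=; rewrite big1 ?IHt ?subr0. Qed.

(** Two insertions occur in both orders, with opposite signs. *)
Lemma boundary_boundary (V : zmodType) t (f : seq T -> V) :
  boundary t (fun u => boundary u f) = 0.
Proof.
elim: t f => [|t0 t IHt] f /=.
  by rewrite sumrB exchange_big subrr.
rewrite boundaryB IHt subr0 boundary_sum !sumrB.
by rewrite exchange_big /= subKr subrr.
Qed.

(* Coning with a vertex, where [P] splits each value of the chain according to
   the vertex that is used. *)
Lemma boundary_cone (V : zmodType) (P : T -> {additive V -> V})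
    (f w : seq T -> V) t :
  (forall c u, w (c :: u) = P c (f u)) -> \sum_c P c (f t) = f t ->
  (if t is _ :: t' then boundary t' f = 0 else True) -> boundary t w = f t.
Proof.
case: t => [|t0 t] wE /= sumP bd0.
  by rewrite -sumP; apply: eq_bigr => c _; rewrite wE.
rewrite [X in _ - X](_ : _ = 0) ?subr0.
  by rewrite -sumP; apply: eq_bigr => c _; rewrite wE.
rewrite -[RHS](raddf0 (P t0)) -bd0 boundary_morph.
by apply: eq_boundary => u _ _; rewrite wE.
Qed.

Variable k : fieldType.

Definition incidence (s t : seq T) : k := boundary t (fun u => (u == s)%:R).

Lemma incidence_subset s t : incidence s t != 0 -> {subset t <= s}.
Proof.
move=> nz x xt; apply: contra_neqT nz => xs.
rewrite /incidence -(boundary0 k t); apply: eq_boundary => u _ sub_tu.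
by case: eqP => // eq_us; rewrite -eq_us sub_tu in xs.
Qed.

Lemma sum_cons_eq (c0 : T) (u v : seq T) :
  \sum_c (c :: u == c0 :: v)%:R = (u == v)%:R :> k.
Proof.
rewrite (bigD1 c0) //= eqseq_cons eqxx big1 ?addr0 // => c neq.
by rewrite eqseq_cons (negPf neq).
Qed.

Lemma incidence_nil c v : incidence (c :: v) [::] = (v == [::])%:R.
Proof. by rewrite /incidence /= sum_cons_eq eq_sym. Qed.

Lemma incidence_cons c v t0 t :
  incidence (c :: v) (t0 :: t) =
  (t0 :: t == v)%:R - (t0 == c)%:R * incidence v t.
Proof.
rewrite /incidence /= sum_cons_eq; congr (_ - _).
case: (t0 =P c) => [->|/eqP/negPf neq].
  by rewrite mul1r; apply: eq_boundary => u _ _; rewrite eqseq_cons eqxx.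
rewrite mul0r -[RHS](boundary0 k t); apply: eq_boundary => u _ _.
by rewrite eqseq_cons neq.
Qed.

(** [f] is expanded in indicator chains of the tuples of length [i.+1], the length that the boundary
    at [t] reads. *)
Lemma boundaryE (V : lmodType k) i (t : i.-tuple T) (f : seq T -> V) :
  boundary t f = \sum_(s : i.+1.-tuple T) incidence s t *: f s.
Proof.
pose phi (v : V) (a : k) : V := a *: v.
have phiB v : zmod_morphism (phi v) by move=> a b; rewrite /phi scalerBl.
pose aphi v : {additive k -> V} :=
  HB.pack (phi v) (GRing.isZmodMorphism.Build k V (phi v) (phiB v)).
rewrite (_ : boundary t f =
    boundary t (fun u => \sum_(s : i.+1.-tuple T) aphi (f s) (u == s)%:R)).
  rewrite boundary_sum; apply: eq_bigr => s _.
  by rewrite -[LHS](boundary_morph (aphi (f s))).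
apply: eq_boundary => u sz_u _; have sz : size u == i.+1 by rewrite sz_u size_tuple.
rewrite (bigD1 (Tuple sz)) //= eqxx /phi scale1r big1 ?addr0 // => s neq.
rewrite (_ : u == s = false) ?scale0r //; apply: contraNF neq => /eqP us.
by apply/eqP/val_inj; rewrite /= us.
Qed.

End OrderedChains.

(** * The Taylor complex and its exactness *)

Section TaylorComplex.
Variables (k : fieldType) (n : nat) (T : finType) (g : T -> 'X_{1..n}).
Implicit Types (s t u : seq T) (m : 'X_{1..n}).

Local Notation S := {mpoly k[n]}.

Definition lcms s : 'X_{1..n} := \big[@mlcm n/0%MM]_(c <- s) g c.

Lemma lcms_le s m : (lcms s <= m)%MM = all (fun c => (g c <= m)%MM) s.
Proof.
rewrite /lcms; elim: s => [|c s IHs]; last by rewrite big_cons lem_mlcm IHs.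
by rewrite big_nil; apply/mnm_lepP => i; rewrite mnm0E.
Qed.

Lemma lcms_cons_le c s m :
  (lcms (c :: s) <= m)%MM = (g c <= m)%MM && (lcms s <= m)%MM.
Proof. by rewrite !lcms_le. Qed.

Lemma lcms_subset s t : {subset t <= s} -> (lcms t <= lcms s)%MM.
Proof.
move=> sub_ts; rewrite lcms_le; apply/allP => c /sub_ts c_s.
by have /allP : all (fun c => (g c <= lcms s)%MM) s; [rewrite -lcms_le; apply/mnm_lepP|exact].
Qed.

(** Basis elements are all tuples, in any order and with repetitions; signs then come from positions
    alone. *)
Definition taylor_rank i : nat := #|{: i.-tuple T}|.

Definition simplex i (a : 'I_(taylor_rank i)) : i.-tuple T := enum_val a.

Definition simplex_rank i (s : i.-tuple T) : 'I_(taylor_rank i) := enum_rank s.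

Lemma simplexK i : cancel (@simplex i) (@simplex_rank i).
Proof. exact: enum_valK. Qed.

Lemma simplex_rankK i : cancel (@simplex_rank i) (@simplex i).
Proof. exact: enum_rankK. Qed.

(** Where the incidence is nonzero, [t] is contained in [s], so the truncated subtraction is a true
    quotient of monomials. *)
Definition taylor_entry s t : S :=
  incidence k s t *: 'X_[lcms s - lcms t].

Definition taylor_diff i : 'M[S]_(taylor_rank i.+1, taylor_rank i) :=
  \matrix_(a, b) taylor_entry (simplex a) (simplex b).

Lemma taylor_entryM s t :
  taylor_entry s t * 'X_[lcms t] = incidence k s t *: 'X_[lcms s].
Proof.
rewrite /taylor_entry; have [->|nz] := eqVneq (incidence k s t) 0.
  by rewrite !scale0r mul0r.
by rewrite -scalerAl -mpolyXD submK ?lcms_subset //; apply: incidence_subset nz.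
Qed.

(* Homogenizing, [v e_t |-> v * 'X_[lcms t]], turns the Taylor differential into
   the boundary of ordered chains with polynomial coefficients. *)
Definition chain i (v : 'rV[S]_(taylor_rank i)) s : S :=
  if insub s is Some t then v 0 (simplex_rank t) * 'X_[lcms s] else 0.

Lemma chain_tuple i (v : 'rV_(taylor_rank i)) (t : i.-tuple T) :
  chain v t = v 0 (simplex_rank t) * 'X_[lcms t].
Proof. by rewrite /chain valK. Qed.

Lemma chain_size i (v : 'rV_(taylor_rank i)) s : size s != i -> chain v s = 0.
Proof. by move=> sz; rewrite /chain insubF //; apply: negbTE. Qed.

Lemma mpolyX_neq0 m : 'X_[m] != 0 :> S.
Proof. by apply/eqP => /mpolyP/(_ m)/eqP; rewrite mcoeffX mcoeff0 eqxx oner_eq0. Qed.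

Lemma chain_inj i (v w : 'rV_(taylor_rank i)) : chain v =1 chain w -> v = w.
Proof.
move=> eq_vw; apply/rowP => a; rewrite -[a]simplexK.
by apply: (mulIf (mpolyX_neq0 (lcms (simplex a)))); rewrite -!chain_tuple eq_vw.
Qed.

Lemma chain_diff i (v : 'rV_(taylor_rank i.+1)) t :
  chain (v *m taylor_diff i) t = boundary t (chain v).
Proof.
have [sz|sz] := eqVneq (size t) i; last first.
  rewrite chain_size // -[LHS](boundary0 S t); apply: eq_boundary => u sz_u _.
  by rewrite chain_size // sz_u.
have -> : t = Tuple (introT eqP sz) by [].
rewrite boundaryE chain_tuple mxE mulr_suml.
rewrite (reindex (@simplex_rank i.+1)) /=; last exact/onW_bij/enum_rank_bij.
apply: eq_bigr => s _; rewrite chain_tuple mxE !simplex_rankK -mulrA.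
by rewrite taylor_entryM -scalerAr.
Qed.

(** Divisibility by [lcms s] allows the homogenization to be undone. *)
Lemma chain_surj i (f : seq T -> S) :
    (forall s, size s != i -> f s = 0) ->
    (forall s m, m \in msupp (f s) -> (lcms s <= m)%MM) ->
  exists w : 'rV_(taylor_rank i), chain w =1 f.
Proof.
move=> f0 f_le.
have /fin_all_exists[w wE] (a : 'I_(taylor_rank i)) :
    exists q, f (simplex a) = q * 'X_[lcms (simplex a)].
  by apply/mpolyX_divP => m /f_le.
exists (\row_a w a) => s; have [sz|sz] := eqVneq (size s) i; last first.
  by rewrite chain_size // f0.
have -> : s = Tuple (introT eqP sz) by [].
move: (Tuple _) => t; have := wE (simplex_rank t); rewrite simplex_rankK => ->.
by rewrite chain_tuple mxE.
Qed.

Lemma msupp_chain i (v : 'rV_(taylor_rank i)) s m :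
  m \in msupp (chain v s) -> (lcms s <= m)%MM.
Proof.
rewrite /chain; case: insubP => [t _ _|_]; last by rewrite msupp0.
by move: m; apply/mpolyX_divP; exists (v 0 (simplex_rank t)).
Qed.

Lemma taylor_diff0 i (w : 'rV_(taylor_rank i.+2)) :
  w *m taylor_diff i.+1 *m taylor_diff i = 0.
Proof.
apply: chain_inj => t; rewrite chain_diff.
rewrite (eq_boundary (g := fun u => boundary u (chain w))); last first.
  by move=> u _ _; rewrite chain_diff.
rewrite boundary_boundary /chain; case: insub => // s.
by rewrite mxE mul0r.
Qed.

(** Each monomial is coned with its chosen divisor [c]; then [lcms (c :: s)] still divides it. The
    second hypothesis asks for a cycle when [i > 0] and is automatic for [i = 0]. *)
Lemma taylor_contract i (v : 'rV_(taylor_rank i)) :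
    (forall s m, m \in msupp (chain v s) -> exists c, (g c <= m)%MM) ->
    (forall c t, boundary t (chain v) = 0 \/ size (c :: t) != i) ->
  exists w, v = w *m taylor_diff i.
Proof.
move=> v_le bd0.
pose P c : {additive S -> S} := mfilter (fun m => divisor predT g m == Some c).
pose f s := if s is c :: s' then P c (chain v s') else 0.
have [|s m|w wE] := chain_surj (i := i.+1) (f := f).
- by case=> //= c s sz; rewrite chain_size ?raddf0 // -eqSS.
- case: s => [|c s] /=; first by rewrite msupp0.
  rewrite msupp_mfilter lcms_cons_le /divisor => /andP[+ /msupp_chain->].
  by case: pickP => // c' /= le_c' /eqP[<-]; rewrite le_c'.
exists w; apply: chain_inj => t; rewrite chain_diff.
have [sz|sz] := eqVneq (size t) i; last first.
  rewrite chain_size // -[LHS](boundary0 S t); apply: eq_boundary => u sz_u _.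
  by rewrite chain_size // sz_u.
symmetry; apply: (boundary_cone (P := P)) => [c u||].
- by rewrite wE.
- rewrite [RHS](sum_mfilter_divisor (P := predT) (g := g)) // => m /v_le[c].
  by exists c.
by case: t sz => // c t sz; case: (bd0 c t) => // /negP[]; apply/eqP.
Qed.

Definition taylor_deg i (a : 'I_(taylor_rank i)) : nat := mdeg (lcms (simplex a)).

Lemma taylor_diff_homog i a b :
  homog_entry (taylor_deg a) (taylor_deg b) (taylor_diff i a b).
Proof.
rewrite mxE /taylor_entry /taylor_deg /homog_entry.
have [->|nz] := eqVneq (incidence k (simplex a) (simplex b)) 0.
  by rewrite scale0r eqxx dhomog0 if_same.
have le_ba := lcms_subset (incidence_subset nz).
rewrite (lem_mdeg le_ba) dhomogZ // dhomogX.
by rewrite -{2}(submK le_ba) mdegD addnK.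
Qed.

Variable I : S -> Prop.
Hypothesis monomial_I : forall p,
  I p <-> forall m, m \in msupp p -> exists c, (g c <= m)%MM.

Definition taylor_aug : 'cV[S]_(taylor_rank 0) := const_mx 1.

Lemma taylor_augE (v : 'rV_(taylor_rank 0)) :
  (v *m taylor_aug) 0 0 = chain v [::].
Proof.
have -> : [::] = [tuple] :> seq T by [].
rewrite chain_tuple /lcms big_nil mpolyX0 mulr1 mxE.
rewrite (reindex (@simplex_rank 0)) /=; last exact/onW_bij/enum_rank_bij.
by rewrite (big_pred1 [tuple]) ?mxE ?mulr1 // => t; rewrite (tuple0 t).
Qed.

Lemma taylor_aug_homog a : homog_entry (taylor_deg a) 0 (taylor_aug a 0).
Proof.
rewrite /homog_entry /taylor_deg (tuple0 (simplex a)) /lcms big_nil mdeg0 mxE.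
exact: dhomog1.
Qed.

Lemma taylor_aug_surj (p : S) :
  exists v : 'rV_(taylor_rank 0), I ((v *m taylor_aug) 0 0 - p).
Proof.
have [|s m|v vE] := chain_surj (i := 0) (f := fun s => if s is [::] then p else 0).
- by case.
- case: s => [|c s]; last by rewrite msupp0.
  by move=> _; rewrite lcms_le.
exists v; rewrite taylor_augE vE subrr; apply/monomial_I => m.
by rewrite msupp0.
Qed.

Lemma taylor_exact0 (v : 'rV_(taylor_rank 0)) :
  I ((v *m taylor_aug) 0 0) <-> exists w, v = w *m taylor_diff 0.
Proof.
rewrite taylor_augE; split=> [/monomial_I Iv|[w ->]].
  apply: taylor_contract => [[|c s] m|c t]; first exact: Iv.
    by rewrite chain_size // msupp0.
  by right.
apply/monomial_I => m; rewrite chain_diff /= mcoeff_msupp raddf_sum /= => nz.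
have [c] : exists c, (chain w [:: c])@_m != 0.
  apply/existsP; apply: contraNT nz => /existsPn all0.
  by rewrite big1 // => c _; apply/eqP/negPn/all0.
rewrite -mcoeff_msupp => /msupp_chain; rewrite lcms_cons_le => /andP[le_cm _].
by exists c.
Qed.

(** In positive degree the first vertex of a simplex divides every monomial of its coefficient, so
    cycles can be contracted. *)
Lemma taylor_exact i (v : 'rV_(taylor_rank i.+1)) :
  v *m taylor_diff i = 0 <-> exists w, v = w *m taylor_diff i.+1.
Proof.
split=> [v0|[w ->]]; last exact: taylor_diff0.
apply: taylor_contract => [[|c s] m|c t].
- by rewrite chain_size // msupp0.
- by move/msupp_chain; rewrite lcms_cons_le => /andP[le_cm _]; exists c.
left; rewrite -chain_diff v0 /chain; case: insub => // s.
by rewrite mxE mul0r.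
Qed.

Definition taylor_resolution : graded_free_resolution I :=
  GradedFreeResolution taylor_diff_homog taylor_aug_homog taylor_aug_surj
    taylor_exact0 taylor_exact.

(** The monomial factor of an entry has constant term 1 exactly when the two lcms agree. *)
Lemma tensor_diff_taylor i (s : i.+1.-tuple T) (t : i.-tuple T) :
  tensor_diff taylor_resolution i (simplex_rank s) (simplex_rank t) =
  incidence k s t * (lcms s == lcms t)%:R.
Proof.
rewrite !mxE !simplex_rankK /taylor_entry mcoeffZ mcoeffX.
have [->|nz] := eqVneq (incidence k s t) 0; first by rewrite !mul0r.
have le_ts := lcms_subset (incidence_subset nz); congr (_ * _%:R); congr nat_of_bool.
apply/eqP/eqP => [d0|->]; last by apply/mnmP => i0; rewrite mnmBE mnm0E subnn.
by rewrite -(submK le_ts) d0 add0m.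
Qed.

(** Each basis element of degree [j] is, up to a unit, a boundary modulo the maximal ideal, so
    boundaries fill that degree. *)
Lemma tor_taylor_eq0 i j :
    (forall t : i.-tuple T, mdeg (lcms t) = j ->
      exists s : i.+1.-tuple T, exists2 a : k, a != 0 &
      forall t' : i.-tuple T,
        incidence k s t' * (lcms s == lcms t')%:R = a * (t' == t)%:R) ->
  tor_dim taylor_resolution i j = 0%N.
Proof.
move=> bd_t; apply/eqP; rewrite subn_eq0; apply: mxrankS.
apply: submx_trans (capmxSr _ _) _; rewrite sub_capmx submx_refl andbT.
apply/row_subP => a; rewrite row_diag_mx mxE.
have [deg_a|_] := eqVneq (gfr_deg a) j; last by rewrite scale0r sub0mx.
have [s [c c_nz sE]] := bd_t (simplex a) deg_a.
rewrite scale1r (_ : delta_mx 0 a =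
  c^-1 *: row (simplex_rank s) (tensor_diff taylor_resolution i)).
  by rewrite scalemx_sub // row_sub.
apply/rowP => b; rewrite mxE [RHS]mxE mxE /= -[b]simplexK tensor_diff_taylor.
rewrite sE mulKf // -[a in LHS]simplexK.
by rewrite (can_eq (@simplex_rankK i)).
Qed.

End TaylorComplex.

(** * Linear presentation of gap-free graphs *)

Section GapFreeLinear.
Variables (k : fieldType) (n : nat) (e : rel 'I_n).
Hypotheses (e_sym : ssrbool.symmetric e) (e_irr : irreflexive e).

(* Orienting the edges makes distinct generators have distinct monomials. *)
Definition edge : finType := {u : 'I_n * 'I_n | (u.1 < u.2)%N && e u.1 u.2}.

Definition ends (u : edge) : {set 'I_n} := [set (val u).1; (val u).2].

Definition gen (u : edge) : 'X_{1..n} := mset (ends u).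

Lemma card_ends u : #|ends u| = 2%N.
Proof. by have /andP[lt_u _] := valP u; rewrite cards2 neq_ltn lt_u. Qed.

Lemma ends_inj : injective ends.
Proof.
move=> u v /setP; rewrite /ends => eq_uv; apply/val_inj.
have [/andP[+ _] /andP[+ _]] := (valP u, valP v); move: eq_uv.
case: (val u) (val v) => [i j] [i' j'] /= eq_uv ij ij'.
have := eq_uv i; have := eq_uv j; rewrite !inE /= !eqxx orbT.
move=> /esym/orP[]/eqP jE /esym/orP[]/eqP iE; subst i j => //; lia.
Qed.

Lemma edge_ends i j : e i j -> exists u : edge, ends u = [set i; j].
Proof.
move=> eij; have := edge_neq e_irr eij; rewrite neq_ltn => /orP[lt_ij|lt_ji].
  have Pu : ((i, j).1 < (i, j).2)%N && e (i, j).1 (i, j).2 by rewrite lt_ij.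
  by exists (Sub (i, j) Pu).
have Pu : ((j, i).1 < (j, i).2)%N && e (j, i).1 (j, i).2 by rewrite lt_ji e_sym.
by exists (Sub (j, i) Pu); rewrite setUC.
Qed.

Lemma edge_ideal_gen p : edge_ideal (k := k) e p <->
  forall m, m \in msupp p -> exists u, (gen u <= m)%MM.
Proof.
rewrite edge_idealP; split=> le_p m /le_p[u].
  case/andP=> eu; case: u eu => i j /= eij; rewrite edge_mon_mset ?(edge_neq e_irr) //.
  by have [u <-] := edge_ends eij; exists u.
have /andP[_ eu] := valP u => le_um; exists (val u).
by rewrite eu [val u]surjective_pairing edge_mon_mset ?(edge_neq e_irr).
Qed.

Lemma lcms_gen s : lcms gen s = mset (\bigcup_(u <- s) ends u).
Proof. by rewrite (big_morph _ (@msetU n) (mset0 n)). Qed.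

(** A union of size 4 makes [u] and [v] disjoint, so [w] joins one end of each. The sizes 3 later
    separate the lcms. *)
Lemma gap_free_connecting (u v : edge) : gap_free e ->
    #|ends u :|: ends v| = 4%N ->
  exists w : edge, [/\ #|ends w :|: ends v| = 3%N, #|ends u :|: ends w| = 3%N &
    ends w \subset ends u :|: ends v].
Proof.
move=> gapf card4.
have dis : [disjoint ends u & ends v].
  rewrite -setI_eq0 -cards_eq0; apply/eqP; move: card4.
  rewrite cardsU !card_ends.
  by have := subset_leq_card (subsetIl (ends u) (ends v)); rewrite card_ends; lia.
have [x [y [xu yv exy]]] : exists x y, [/\ x \in ends u, y \in ends v & e x y].
  have neq x y : x \in ends u -> y \in ends v -> (x == y) = false.
    by move=> xu yv; apply: contraTF xu => /eqP ->; rewrite (disjointFl dis yv).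
  have [/andP[_ eu] /andP[_ ev]] := (valP u, valP v).
  have := gapf _ _ _ _ eu ev; rewrite !neq ?set21 ?set22 //=.
  by case/or4P; [exists (val u).1, (val v).1|exists (val u).1, (val v).2
    |exists (val u).2, (val v).1|exists (val u).2, (val v).2];
    rewrite ?set21 ?set22.
have [w wE] := edge_ends exy; exists w.
have xv : x \notin ends v by rewrite (disjointFr dis xu).
have yu : y \notin ends u by rewrite (disjointFl dis yv).
split; rewrite ?wE.
- have -> : [set x; y] :|: ends v = x |: ends v.
    by rewrite -setUA; congr (_ :|: _); apply/setUidPr; rewrite sub1set.
  by rewrite cardsU1 xv card_ends.
- have -> : ends u :|: [set x; y] = y |: ends u.
    by rewrite [[set x; y]]setUC setUCA; congr (_ :|: _); apply/setUidPl; rewrite sub1set.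
  by rewrite cardsU1 yu card_ends.
by rewrite subUset !sub1set; apply/andP; split; apply/setUP; [left|right].
Qed.

Lemma gap_free_linearly_presented :
  gap_free e -> linearly_presented (@edge_ideal k n e).
Proof.
move=> gapf j j3; exists (taylor_resolution edge_ideal_gen).
apply: tor_taylor_eq0 => t; case/tupleP: t => u t; case/tupleP: t => v t.
rewrite (tuple0 t) /= => {t} deg_j.
have entry (x y z : edge) (t' : 2.-tuple edge) : incidence k [:: x; y; z] t' =
    (t' == [tuple y; z])%:R - (t' == [tuple x; z])%:R + (t' == [tuple x; y])%:R.
  case/tupleP: t' => p t'; case/tupleP: t' => q t'; rewrite (tuple0 t').
  rewrite -!val_eqE /= !incidence_cons incidence_nil !eqseq_cons !eqxx !andbT.
  by case: (p == x); case: (p == y); case: (q == z); case: (q == y) => /=; ring.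
(* For a repeated edge, the signs 1 - 1 + 1 make [(u, u)] the boundary of [(u, u, u)]. *)
have [<-|neq_uv] := eqVneq u v.
  exists [tuple u; u; u], 1; rewrite ?oner_eq0 // => t'; rewrite entry subrr add0r mul1r.
  case: eqP => [->|]; last by rewrite mul0r.
  by rewrite mul1r !lcms_gen /= !big_cons big_nil !setU0 !setUid eqxx.
(* The union has 2, 3 or 4 vertices; 2 would give [u = v], and 3 is excluded by [j3]. *)
have card4 : #|ends u :|: ends v| = 4%N.
  move: deg_j; rewrite lcms_gen mdeg_mset !big_cons big_nil setU0 => deg_j.
  have : (#|ends u :|: ends v| <= 4)%N by rewrite cardsU !card_ends leq_subr.
  suff : #|ends u :|: ends v| != 2%N.
    have := subset_leq_card (subsetUl (ends u) (ends v)); rewrite card_ends; lia.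
  apply: contra neq_uv => /eqP card2; apply/eqP/ends_inj.
  have -> : ends u = ends u :|: ends v.
    by apply/eqP; rewrite eqEcard subsetUl card2 card_ends.
  by symmetry; apply/eqP; rewrite eqEcard subsetUr card2 card_ends.
have [w [card_wv card_uw sub_w]] := gap_free_connecting gapf card4.
have lcm_eq : lcms gen [:: u; w; v] = lcms gen [:: u; v].
  rewrite !lcms_gen !big_cons big_nil !setU0 setUCA.
  by congr mset; apply/setUidPr.
have lcm_wv : (lcms gen [:: u; v] == lcms gen [:: w; v]) = false.
  apply/eqP => /(congr1 (@mdeg n)); rewrite !lcms_gen !mdeg_mset !big_cons big_nil.
  by rewrite !setU0 card4 card_wv.
have lcm_uw : (lcms gen [:: u; v] == lcms gen [:: u; w]) = false.
  apply/eqP => /(congr1 (@mdeg n)); rewrite !lcms_gen !mdeg_mset !big_cons big_nil.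
  by rewrite !setU0 card4 card_uw.
(* The faces [(w, v)] and [(u, w)] have smaller lcms and vanish; the middle face [(u, v)] carries
   the sign -1. *)
exists [tuple u; w; v], (-1); rewrite ?oppr_eq0 ?oner_eq0 // => t'.
rewrite entry lcm_eq.
case: (t' =P [tuple w; v]) => [->|_].
  rewrite lcm_wv mulr0 (_ : _ == _ = false) ?mulr0 //.
  by apply/eqP => /(congr1 val) /= wv; rewrite wv eqxx in lcm_wv.
case: (t' =P [tuple u; w]) => [->|_].
  rewrite lcm_uw mulr0 (_ : _ == _ = false) ?mulr0 //.
  by apply/eqP => /(congr1 val) /= uw; rewrite uw eqxx in lcm_uw.
rewrite addr0 sub0r !mulN1r mulNr; congr (- _).
by case: eqP => [->|_]; rewrite ?mul0r // eqxx mulr1.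
Qed.

End GapFreeLinear.

(** * A gap gives a quadratic syzygy *)

Section MonomialRetract.
Variables (k : fieldType) (n : nat) (A : pred 'X_{1..n}).
Hypotheses (A0 : A 0%MM) (AD : forall m1 m2, A (m1 + m2)%MM = A m1 && A m2).

(** By [AD], the monomials outside [A] span an ideal, and those in [A] are closed under products. *)
Lemma mfilter_is_monoid_morphism :
  monoid_morphism (mfilter A : {mpoly k[n]} -> {mpoly k[n]}).
Proof.
split=> [|p q]; apply/mpolyP => m; rewrite mcoeff_mfilter.
  by rewrite mcoeff1; case: eqP => [->|]; rewrite ?A0 ?if_same.
rewrite !mcoeffM; case Am: (A m).
  apply: eq_bigr => u /eqP def_m; have := AD u.1 u.2; rewrite -def_m Am.
  by case/esym/andP=> A1 A2; rewrite !mcoeff_mfilter A1 A2.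
rewrite big1 // => u /eqP def_m; have := AD u.1 u.2; rewrite -def_m Am.
rewrite !mcoeff_mfilter; case: (A u.1) => [/= <-|_]; rewrite ?mulr0 ?mul0r //.
Qed.

Definition mretract : {rmorphism {mpoly k[n]} -> {mpoly k[n]}} :=
  HB.pack (mfilter A : {mpoly k[n]} -> {mpoly k[n]})
    (GRing.isZmodMorphism.Build _ _ _ (@mfilter_is_additive k n A))
    (GRing.isMonoidMorphism.Build _ _ _ mfilter_is_monoid_morphism).

Lemma mcoeff_mretract p : (mretract p)@_0%MM = p@_0%MM.
Proof. by rewrite mcoeff_mfilter A0. Qed.

Lemma msupp_mretract p m : (m \in msupp (mretract p)) = A m && (m \in msupp p).
Proof. exact: msupp_mfilter. Qed.

End MonomialRetract.

(** * Degree bookkeeping for homogeneous matrices *)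

Section HomogeneousMaps.
Variables (k : fieldType) (n : nat).
Implicit Types p q : {mpoly k[n]}.

(* [p] is homogeneous of degree [b - a]: zero when [b < a]. *)
Definition hom_deg a b p : Prop := forall m, m \in msupp p -> (mdeg m + a = b)%N.

Lemma homog_entry_deg s t p : homog_entry s t p -> hom_deg t s p.
Proof.
rewrite /homog_entry; case: leqP => [le_ts /dhomogP p_hom m /p_hom /= ->|_ /eqP->].
  exact: subnK.
by move=> m; rewrite msupp0.
Qed.

Lemma hom_degM a b c p q : hom_deg b c p -> hom_deg a b q -> hom_deg a c (p * q).
Proof.
move=> hp hq m /msuppM_le /allpairsP[[m1 m2] /= [/hp <- /hq <- ->]].
by rewrite mdegD addnA.
Qed.

Lemma hom_deg_sum (T : eqType) (r : seq T) (P : pred T) a b (F : T -> {mpoly k[n]}) :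
  (forall i, hom_deg a b (F i)) -> hom_deg a b (\sum_(i <- r | P i) F i).
Proof.
move=> hF m /msupp_sum_le /flattenP[s /mapP[i _ ->]]; exact: hF.
Qed.

Lemma hom_deg_mulmx (r1 r2 : nat) a (d1 : 'I_r1 -> nat) (d2 : 'I_r2 -> nat)
    (D : 'M[{mpoly k[n]}]_(r2, r1)) (v : 'cV_r1) :
  (forall i j, hom_deg (d1 j) (d2 i) (D i j)) ->
  (forall j, hom_deg a (d1 j) (v j 0)) ->
  forall i, hom_deg a (d2 i) ((D *m v) i 0).
Proof.
by move=> hD hv i; rewrite mxE; apply: hom_deg_sum => j; apply: hom_degM (hD i j) (hv j).
Qed.

Lemma hom_deg_quotient a b l p q :
  p = q * 'X_[l] -> hom_deg a b p -> hom_deg (mdeg l + a) b q.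
Proof.
move=> -> hp m m_q; rewrite -(hp (m + l)%MM) ?mdegD ?addnA //.
by rewrite mcoeff_msupp addmC mcoeffMX -mcoeff_msupp.
Qed.

End HomogeneousMaps.

(** * Cycles and degrees in an arbitrary graded resolution *)

Section Resolution.
Variables (k : fieldType) (n : nat) (I : {mpoly k[n]} -> Prop).
Variable F : graded_free_resolution I.

Local Notation S := {mpoly k[n]}.
Local Notation d := (gfr_diff F).

Lemma gfr_diff_diff i : d i.+1 *m d i = 0.
Proof.
apply/row_matrixP => c; rewrite row_mul row0.
by apply/(gfr_exact (g := F)); exists (delta_mx 0 c); rewrite rowE.
Qed.

Lemma gfr_diff_aug s : I ((d 0 *m gfr_aug F) s 0).
Proof.
have -> : (d 0 *m gfr_aug F) s 0 = (row s (d 0) *m gfr_aug F) 0 0.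
  by rewrite -row_mul [RHS]mxE.
by apply/(gfr_exact0 (g := F)); exists (delta_mx 0 s); rewrite rowE.
Qed.

Lemma gfr_diff_deg i a b : hom_deg (gfr_deg b) (gfr_deg a) (d i a b).
Proof. exact/homog_entry_deg/gfr_diff_homog. Qed.

Lemma gfr_aug_deg a : hom_deg 0 (gfr_deg a) (gfr_aug F a 0).
Proof. exact/homog_entry_deg/gfr_aug_homog. Qed.

Lemma tensor_diffE i : tensor_diff F i = map_mx (mcoeff 0%MM) (d i).
Proof. by []. Qed.

Lemma tensor_diff_diff i : tensor_diff F i.+1 *m tensor_diff F i = 0.
Proof. by rewrite !tensor_diffE -map_mxM gfr_diff_diff map_mx0. Qed.

(** An entry with nonzero constant term joins basis elements of equal degree, so projecting to
    degree [j] commutes with the differential. *)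
Lemma tensor_diff_degree i j :
  tensor_degree F i.+1 j *m tensor_diff F i =
  tensor_diff F i *m tensor_degree F i j.
Proof.
apply/matrixP => a b; rewrite mul_diag_mx mul_mx_diag !mxE mulrC.
have [->|nz] := eqVneq (d i a b)@_0%MM 0; first by rewrite !mul0r.
have := @gfr_diff_deg i a b 0%MM; rewrite mcoeff_msupp nz mdeg0 add0n => -> //.
Qed.

(** Vanishing of the truncated difference only bounds the rank of cycles by that of boundaries;
    since boundaries are cycles, the spaces coincide. *)
Lemma tor_dim_eq0 i j (z : 'rV_(gfr_rank F i.+1)) :
    tor_dim F i.+1 j = 0%N -> z *m tensor_diff F i = 0 ->
  exists w, z *m tensor_degree F i.+1 j = w *m tensor_diff F i.+1.
Proof.
move=> /eqP; rewrite subn_eq0 => tor0 z_cycle.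
set Z := (tensor_cycles F i.+1 :&: _)%MS in tor0.
set B := (tensor_diff F i.+1 :&: _)%MS in tor0.
have sBZ : (B <= Z)%MS.
  by apply: capmxS => //; apply/sub_kermxP; apply: tensor_diff_diff.
have sZB : (Z <= B)%MS by rewrite -(geq_leqif (mxrank_leqif_sup sBZ)).
apply/submxP; apply: submx_trans (capmxSl _ (tensor_degree F i.+1 j)).
apply: submx_trans sZB; rewrite sub_capmx submxMl andbT.
by apply/sub_kermxP; rewrite -mulmxA tensor_diff_degree mulmxA z_cycle mul0mx.
Qed.

End Resolution.

(** * Comparison with the Koszul complex of a gap *)

Section Gap.
Variables (k : fieldType) (n : nat) (e : rel 'I_n).
Hypotheses (e_sym : ssrbool.symmetric e) (e_irr : irreflexive e).
Variable F : graded_free_resolution (@edge_ideal k n e).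
Variables a b c d : 'I_n.
Hypotheses (ab : e a b) (cd : e c d).
Hypothesis gap :
  ~~ [|| a == c, a == d, b == c, b == d, e a c, e a d, e b c | e b d].

Local Notation S := {mpoly k[n]}.

Definition gap_vertices : {set 'I_n} := [set a; b] :|: [set c; d].

Definition on_gap (m : 'X_{1..n}) : bool :=
  [forall i, (i \in gap_vertices) || (m i == 0%N)].

Lemma on_gap0 : on_gap 0%MM.
Proof. by apply/forallP => i; rewrite mnm0E eqxx orbT. Qed.

Lemma on_gapD m1 m2 : on_gap (m1 + m2)%MM = on_gap m1 && on_gap m2.
Proof.
apply/forallP/andP => [gm|[/forallP g1 /forallP g2] i].
  by split; apply/forallP => i; have := gm i; rewrite mnmDE addn_eq0;
    case: (i \in _) => //= /andP[].
by have := g1 i; have := g2 i; rewrite mnmDE addn_eq0; case: (i \in _) => //= -> ->.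
Qed.

Local Notation sigma := (mretract k on_gap0 on_gapD).
Local Notation alpha := (edge_mon (a, b)).
Local Notation beta := (edge_mon (c, d)).

Lemma on_gap_alpha : on_gap alpha.
Proof.
apply/forallP => i; rewrite edge_mon_mset ?(edge_neq e_irr) // mnmE !inE.
by case: (i == a); case: (i == b); rewrite ?orbT.
Qed.

Lemma on_gap_beta : on_gap beta.
Proof.
apply/forallP => i; rewrite edge_mon_mset ?(edge_neq e_irr) // mnmE !inE.
by case: (i == c); case: (i == d); rewrite ?orbT.
Qed.

Lemma gap_disjoint : [disjoint [set a; b] & [set c; d]].
Proof.
move: gap; rewrite !negb_or => /and5P[ac ad bc bd _].
rewrite -setI_eq0; apply/eqP/setP => i; rewrite !inE; apply/negbTE/negP => /andP[].
by case/orP=> /eqP-> /orP[]; apply/negP.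
Qed.

(** The two edges have disjoint supports. *)
Lemma alpha_coprime m : (beta <= m + alpha)%MM = (beta <= m)%MM.
Proof.
apply/mnm_lepP/mnm_lepP => le_m i; last first.
  by apply: leq_trans (le_m i) _; rewrite mnmDE leq_addr.
have := le_m i; rewrite mnmDE !edge_mon_mset ?(edge_neq e_irr) // !mnmE.
case: (boolP (i \in [set c; d])) => // i_cd.
by rewrite (disjointFl gap_disjoint i_cd) addn0.
Qed.

Lemma beta_alpha : (beta <= alpha)%MM = false.
Proof.
rewrite !edge_mon_mset ?(edge_neq e_irr) // mset_le; apply/subsetP => /(_ c).
by rewrite set21 (disjointFl gap_disjoint) ?set21 // => /(_ isT).
Qed.

Lemma alpha_beta : (alpha <= beta)%MM = false.
Proof.
rewrite !edge_mon_mset ?(edge_neq e_irr) // mset_le; apply/subsetP => /(_ a).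
by rewrite set21 (disjointFr gap_disjoint) ?set21 // => /(_ isT).
Qed.

(** Monomials of [sigma p] are divisible by an edge on the gap vertices, which is [ab] or [cd]. The
    support clause lets [f] inherit degrees from [p]. *)
Lemma sigma_edge_ideal p : edge_ideal e p ->
  exists f g, sigma p = f * 'X_[alpha] + g * 'X_[beta] /\
    (forall m, m \in msupp f -> (m + alpha)%MM \in msupp p).
Proof.
move=> /edge_idealP I_p; pose A m := (alpha <= m)%MM.
have [|f def_f] := (mpolyX_divP (mfilter A (sigma p)) alpha).1.
  by move=> m; rewrite msupp_mfilter => /andP[].
have [|g def_g] := (mpolyX_divP (mfilter (predC A) (sigma p)) beta).1.
  move=> m; rewrite msupp_mfilter msupp_mretract => /and3P[/= /negP nAm gm /I_p].
  case=> -[x y] /andP[/= exy le_m].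
  have on_edge z : z \in [set x; y] -> z \in gap_vertices.
    move=> z_xy; have /forallP/(_ z) := gm; case: (z \in gap_vertices) => //=.
    move/mnm_lepP: le_m => /(_ z); rewrite edge_mon_mset ?(edge_neq e_irr) //.
    by rewrite mnmE z_xy; case: (m z).
  have [eac ead ebc ebd] : [/\ e a c = false, e a d = false, e b c = false & e b d = false].
    by move: gap; rewrite !negb_or => /and5P[_ _ _ _ /and4P[]]; do 4!move/negPf->.
  move: le_m exy; have /setUP[/set2P[]->|/set2P[]->] := on_edge x (set21 _ _);
    have /setUP[/set2P[]->|/set2P[]->] := on_edge y (set22 _ _); rewrite ?e_irr //;
    by rewrite ?eac ?ead ?ebc ?ebd ?(e_sym c) ?(e_sym d) ?eac ?ead ?ebc ?ebd //
      /edge_mon /= addmC.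
exists f, g; split.
  rewrite -def_f -def_g; apply/mpolyP => m; rewrite mcoeffD !mcoeff_mfilter /=.
  by case: (A m); rewrite ?addr0 ?add0r.
move=> m m_f; have : (m + alpha)%MM \in msupp (mfilter A (sigma p)).
  by rewrite def_f mcoeff_msupp addmC mcoeffMX -mcoeff_msupp.
by rewrite msupp_mfilter msupp_mretract => /and3P[].
Qed.

Local Notation d_ := (gfr_diff F).
Local Notation eps := (map_mx (mcoeff 0%MM)).

(* [f], [g] lift the retraction of S/I onto S/(X^alpha, X^beta) to degree 1,
   and [h] lifts it to degree 2, where the Koszul complex ends. *)
Lemma gap_chain_map : exists f g : 'cV[S]_(gfr_rank F 1), exists h : 'cV[S]_(gfr_rank F 2),
  [/\ map_mx sigma (d_ 0 *m gfr_aug F) = 'X_[alpha] *: f + 'X_[beta] *: g,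
      map_mx sigma (d_ 1) *m f = 'X_[beta] *: h,
      tensor_diff F 2 *m eps h = 0 &
      tensor_degree F 2 4 *m eps h = eps h].
Proof.
have /fin_all_exists[f0 f0E] := fun s => sigma_edge_ideal (gfr_diff_aug (F := F) s).
have /fin_all_exists[g0 fgE] := f0E.
pose f : 'cV_(gfr_rank F 1) := \col_s f0 s; pose g : 'cV_(gfr_rank F 1) := \col_s g0 s.
have fg : map_mx sigma (d_ 0 *m gfr_aug F) = 'X_[alpha] *: f + 'X_[beta] *: g.
  by apply/colP => s; rewrite mxE (fgE s).1 !mxE mulrC [_ * g0 s]mulrC.
have f_deg s : hom_deg 2 (gfr_deg s) (f s 0).
  move=> m; rewrite mxE => /(fgE s).2.
  have := hom_deg_mulmx (@gfr_diff_deg _ _ _ F 0) (@gfr_aug_deg _ _ _ F) (i := s).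
  by move=> H /H <-; rewrite mdegD mdeg_edge_mon addn0.
have d1fg : map_mx sigma (d_ 1) *m ('X_[alpha] *: f + 'X_[beta] *: g) = 0.
  by rewrite -fg -map_mxM mulmxA gfr_diff_diff mul0mx map_mx0.
(* By [d1fg], ['X_[beta]] divides ['X_[alpha]] times this entry, hence the entry itself by
   coprimality. *)
have /fin_all_exists[h0 hE] i : exists q, (map_mx sigma (d_ 1) *m f) i 0 = q * 'X_[beta].
  apply/mpolyX_divP => m m_f; rewrite -alpha_coprime.
  have pq (p q : 'cV[S]_(gfr_rank F 2)) : 'X_[alpha] *: p + 'X_[beta] *: q = 0 ->
      p i 0 * 'X_[alpha] = - q i 0 * 'X_[beta].
    move/colP/(_ i); rewrite !mxE => /eqP; rewrite addr_eq0 => /eqP.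
    by rewrite mulNr mulrC [q i 0 * _]mulrC.
  rewrite mulmxDr -!scalemxAr in d1fg.
  have : (m + alpha)%MM \in msupp ((map_mx sigma (d_ 1) *m f) i 0 * 'X_[alpha]).
    by rewrite mcoeff_msupp addmC mcoeffMX -mcoeff_msupp.
  rewrite (pq _ _ d1fg); move: (m + alpha)%MM; apply/mpolyX_divP.
  by exists (- (map_mx sigma (d_ 1) *m g) i 0).
pose h : 'cV_(gfr_rank F 2) := \col_i h0 i.
have fh : map_mx sigma (d_ 1) *m f = 'X_[beta] *: h.
  by apply/colP => i; rewrite hE !mxE mulrC.
have h_deg i : hom_deg 4 (gfr_deg i) (h i 0).
  have -> : 4%N = (mdeg beta + 2)%N by rewrite mdeg_edge_mon.
  rewrite mxE; apply: hom_deg_quotient (hE i) _.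
  apply: (hom_deg_mulmx _ f_deg) => {}i s m; rewrite mxE msupp_mretract => /andP[_].
  exact: gfr_diff_deg.
exists f, g, h; split=> //.
  (* ['X_[beta]] is cancelled from the image of [d_ 2 *m d_ 1 = 0]. *)
  have d2h : map_mx sigma (d_ 2) *m h = 0.
    apply/colP => i; apply: (mulfI (mpolyX_neq0 k beta)).
    have -> : 'X_[beta] * (map_mx sigma (d_ 2) *m h) i 0 =
        ('X_[beta] *: (map_mx sigma (d_ 2) *m h)) i 0 by rewrite [RHS]mxE.
    rewrite scalemxAr -fh mulmxA -map_mxM gfr_diff_diff map_mx0 mul0mx.
    by rewrite !mxE mulr0.
  have -> : tensor_diff F 2 = eps (map_mx sigma (d_ 2)).
    by apply/matrixP => i j; rewrite !mxE mcoeff_mretract.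
  by rewrite -map_mxM d2h map_mx0.
(* By [h_deg], an entry of [h] has a constant term only at basis elements of degree 4. *)
apply/colP => i; rewrite mul_diag_mx mxE.
have [->|nz] := eqVneq (eps h i 0) 0; first by rewrite mulr0.
have deg4 : gfr_deg i = 4%N.
  have := h_deg i 0%MM; rewrite mdeg0 => <- //.
  by rewrite mcoeff_msupp; move: nz; rewrite mxE.
by rewrite [X in X * _]mxE deg4 eqxx mul1r.
Qed.

Lemma mcoeffXM (l m : 'X_{1..n}) (p : S) :
  ('X_[l] * p)@_m = if (l <= m)%MM then p@_(m - l) else 0.
Proof. by rewrite mulrC mcoeffMXE. Qed.

Lemma mcoeffXM_same (l : 'X_{1..n}) (p : S) : ('X_[l] * p)@_l = p@_0%MM.
Proof. by rewrite -[X in _@_X]addm0 mulrC mcoeffMX. Qed.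

Lemma gap_coeff_alpha (p q y : 'M[S]_1) :
  'X_[alpha] *: p + 'X_[beta] *: q = 'X_[alpha] *: y ->
  (p 0 0)@_0%MM = (y 0 0)@_0%MM.
Proof.
move=> /matrixP/(_ 0 0)/mpolyP/(_ alpha); rewrite !mxE mcoeffD !mcoeffXM_same.
by rewrite mcoeffXM beta_alpha addr0.
Qed.

Lemma gap_coeff_beta (p q y : 'M[S]_1) :
  'X_[beta] *: p = 'X_[beta] *: y - 'X_[alpha] *: q ->
  (p 0 0)@_0%MM = (y 0 0)@_0%MM.
Proof.
move=> /matrixP/(_ 0 0)/mpolyP/(_ beta); rewrite !mxE mcoeffB !mcoeffXM_same.
by rewrite mcoeffXM alpha_beta subr0.
Qed.

Lemma edge_mon_le0 (i j : 'I_n) : (edge_mon (i, j) <= 0)%MM = false.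
Proof. by apply/negbTE/negP => /lem_mdeg; rewrite mdeg_edge_mon mdeg0. Qed.

(** [u], [va], [vb] and [z] lift the Koszul complex into [F]. Mapping back by [h], the image of [z]
    has constant term 1, yet vanishing Tor would make it 0. *)
Lemma gap_tor_neq0 : tor_dim F 2 4 <> 0%N.
Proof.
move=> tor0; have [f [g [h [fg fh h3 h4]]]] := gap_chain_map.
have [u uE] := gfr_aug_surj F 1.
have lift i j : e i j -> exists v, 'X_[edge_mon (i, j)] *: u = v *m d_ 0.
  move=> eij; apply/(gfr_exact0 (g := F)); rewrite -scalemxAl mxE.
  apply/edge_idealP => m; rewrite mcoeff_msupp mcoeffXM.
  by case: ifP => [le_m _|_ /eqP//]; exists (i, j); rewrite eij.
have [va vaE] := lift a b ab; have [vb vbE] := lift c d cd.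
(* The Koszul syzygy of ['X_[alpha]] and ['X_[beta]] lifts by exactness. *)
have [z zE] : exists z, 'X_[beta] *: va - 'X_[alpha] *: vb = z *m d_ 1.
  apply/(gfr_exact (g := F)); rewrite mulmxBl -!scalemxAl -vaE -vbE !scalerA.
  by rewrite [X in X *: _]mulrC subrr.
have z_cycle : eps z *m tensor_diff F 1 = 0.
  rewrite tensor_diffE -map_mxM -zE; apply/rowP => i; rewrite !mxE /= mcoeffB.
  by rewrite !mcoeffXM !edge_mon_le0 subrr.
(* [h4] restricts [eps z] to degree 4, where it is a boundary, and [h3] kills boundaries. *)
have zh : (eps z *m eps h) 0 0 = 0.
  have [w wE] := tor_dim_eq0 tor0 z_cycle.
  by rewrite -h4 mulmxA wE -mulmxA h3 mulmx0 mxE.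
pose y := u *m gfr_aug F.
(* [y] is 1 modulo the edge ideal, whose elements have no constant term. *)
have y0 : (sigma (y 0 0))@_0%MM = 1.
  rewrite mcoeff_mretract; apply/eqP; rewrite -subr_eq0.
  have -> : (y 0 0)@_0%MM - 1 = (y 0 0 - 1)@_0%MM by rewrite raddfB /= mcoeff1 eqxx.
  rewrite mcoeff_eq0; apply/negP => /(edge_idealP _ _).1; move/(_ _ uE) => [[i j]].
  by rewrite edge_mon_le0 andbF.
pose p := map_mx sigma va *m f.
have p0 : (p 0 0)@_0%MM = 1.
  have : map_mx sigma va *m ('X_[alpha] *: f + 'X_[beta] *: g) =
      'X_[alpha] *: map_mx sigma y.
    rewrite -fg -map_mxM mulmxA -vaE -scalemxAl map_mxZ.
    by rewrite /= mfilterX ?on_gap_alpha.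
  by rewrite mulmxDr -!scalemxAr => /gap_coeff_alpha; rewrite [map_mx _ _ 0 0]mxE y0.
have : map_mx sigma z *m ('X_[beta] *: h) =
    'X_[beta] *: p - 'X_[alpha] *: (map_mx sigma vb *m f).
  rewrite -fh mulmxA -map_mxM -zE map_mxB !map_mxZ /= !mfilterX ?on_gap_alpha ?on_gap_beta //.
  by rewrite mulmxBl -!scalemxAl.
rewrite -scalemxAr => /gap_coeff_beta; rewrite p0 => /eqP.
suff -> : ((map_mx sigma z *m h) 0 0)@_0%MM = (eps z *m eps h) 0 0.
  by rewrite zh eq_sym oner_eq0.
have -> : eps z = eps (map_mx sigma z).
  by apply/rowP => i; rewrite !mxE mcoeff_mretract.
by rewrite -map_mxM [RHS]mxE.
Qed.

End Gap.

Theorem theorem6p2 (k : fieldType) (n : nat) (e : rel 'I_n)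
    (e_sym : ssrbool.symmetric e) (e_irr : irreflexive e)
    (e_conn : connected_graph e) (e_nontriv : nontrivial_graph e) :
  [/\ graph_free C4 (complement_graph e)
        <-> graded_lattice (lcm_lattice (@edge_ideal k n e)) (@mdivides n),
      graded_lattice (lcm_lattice (@edge_ideal k n e)) (@mdivides n)
        <-> linearly_presented (@edge_ideal k n e) &
      graph_free C4 (complement_graph e) ->
        forall rk : 'X_{1..n} -> int,
          rank_function (lcm_lattice (@edge_ideal k n e)) (@mdivides n) rk ->
        forall m : 'X_{1..n}, lcm_lattice (@edge_ideal k n e) m -> m <> 0%MM ->
          rk m = ((mdeg m)%:Z - 1)%R].
Proof.
have C4P := gap_freeP e_sym e_irr.
have gradedP : gap_free e <->
    graded_lattice (lcm_lattice (@edge_ideal k n e)) (@mdivides n).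
  by split; [exact: gap_free_graded|exact: graded_gap_free].
split; [by rewrite C4P| |by rewrite C4P => /gap_free_rank; apply].
rewrite -gradedP; split; first exact: gap_free_linearly_presented.
(* A gap contributes in degree 4; [F] is whichever resolution the hypothesis supplies. *)
move=> /(_ 4%N)[//|F tor0] a b c d ab cd; apply/negPn/negP => gap.
exact: (gap_tor_neq0 e_sym e_irr ab cd gap tor0).
Qed.
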